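(* Let $(X,+,d)$ and $(Y,+,\rho)$ be metric abelian groups such that $2X$ is unbounded by $d$. Let $\varphi\colon[0,\infty)\to\mathbb{R}$ be such that $\lim_{t\to\infty}\varphi(t)=\infty$, and let $f\colon X\to Y$ satisfy $$\limsup_{\min(\|x\|_d,\|y\|_d)\to\infty}\varphi(\|x-y\|_d)\cdot\|f(x+y)-f(x)-f(y)\|_\rho<\infty.$$ Then $f(x+y)=f(x)+f(y)$ for all $x,y\in X$.
   Context: A metric abelian group is a triple $(X,+,d)$ where $(X,+)$ is an abelian group and $d$ is a translation invariant metric on $X$ (i.e. $d(x+z,y+z)=d(x,y)$ for all $x,y,z\in X$). Write $\|x\|_d:=d(x,0)$; this is an even subadditive function on $X$, not necessarily positively homogeneous. $2X:=\{x+x: x\in X\}$, and ''$2X$ is unbounded by $d$'' means $\sup_{x\in X}\|2x\|_d=\infty$. For a real-valued function $F$ on $X\times X$, $\limsup_{\min(\|x\|_d,\|y\|_d)\to\infty}F(x,y)$ denotes $\inf_{r>0}\sup\{F(x,y): x,y\in X,\ \|x\|_d\geq r,\ \|y\|_d\geq r\}$ in the extended reals. *)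

(* Defs.v *)
From mathcomp Require Import all_boot all_order all_algebra.
From mathcomp Require Import all_classical all_reals all_analysis.

Set Implicit Arguments.
Unset Strict Implicit.
Unset Printing Implicit Defensive.

Import Order.TTheory GRing.Theory Num.Theory.
Import numFieldNormedType.Exports.

Local Open Scope classical_set_scope.
Local Open Scope ring_scope.

(* The first four fields are the axioms of the library factory [isMetric]; the
   metric is kept as an explicit function because joining [metricType] with
   [zmodType] as a packed structure is rejected by Hierarchy-Builder (missing
   join with [pseudoMetricNormedZmodType]). Nonnegativity follows from them. *)
Record invariant_metric (R : realType) (X : zmodType) (d : X -> X -> R) : Prop :=
  InvariantMetric {
    imetricxx : forall x, d x x = 0;
    imetric_positivity : forall x y, d x y = 0 -> x = y;
    imetric_sym : forall x y, d x y = d y x;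
    imetric_triangle : forall y x z, d x z <= d x y + d y z;
    imetricDr : forall x y z, d (x + z) (y + z) = d x y
  }.

(* Not a norm in the sense of [normedZmodType]: [mnorm d (x *+ n)] may differ
   from [mnorm d x *+ n]. *)
Definition mnorm (R : realType) (X : zmodType) (d : X -> X -> R) (x : X) : R :=
  d x 0.

(* Unfolds to [limf_esup] of F over the sets where both norms are at least r;
   [limf_esup] itself requires a [filteredType], which X * X does not carry. *)
Definition limsup_min_mnorm (R : realType) (X : zmodType) (d : X -> X -> R)
    (F : X -> X -> R) : \bar R :=
  ereal_inf [set ereal_sup [set (F p.1 p.2)%:E | p in
               [set p : X * X | r <= mnorm d p.1 /\ r <= mnorm d p.2]]
            | r in [set r : R | 0 < r]].

(* Main.v *)
(* Write x = a + b and y = c + e. The two ways of grouping a + b + c + e express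
   f (x + y) - f x - f y through the Cauchy differences of f at (a, b), (c, e),
   (a, c), (b, e) and (a + c, b + e). With a = u, b = x - u, c = v, e = y - v,
   where 2u is large and 2v is much larger still, these five pairs have large
   entries and large differences, so all five Cauchy differences are small. *)

Require Import Defs.
From mathcomp Require Import all_boot all_order all_algebra.
From mathcomp Require Import all_classical all_reals all_analysis.
From mathcomp Require Import lra.

Set Implicit Arguments.
Unset Strict Implicit.
Unset Printing Implicit Defensive.

Import Order.TTheory GRing.Theory Num.Theory.
Import numFieldNormedType.Exports.

Local Open Scope classical_set_scope.
Local Open Scope ring_scope.

Section InvariantMetric.
Context {R : realType} {X : zmodType} (d : X -> X -> R).
Hypothesis d_metric : invariant_metric d.

Lemma imetric_mnormB x y : d x y = mnorm d (x - y).
Proof. by rewrite /mnorm -(imetricDr d_metric x y (- y)) subrr. Qed.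

Lemma mnormN x : mnorm d (- x) = mnorm d x.
Proof.
by rewrite -sub0r -imetric_mnormB (imetric_sym d_metric) /mnorm.
Qed.

Lemma ler_mnormD x y : mnorm d (x + y) <= mnorm d x + mnorm d y.
Proof.
have := imetric_triangle d_metric 0 x (- y).
by rewrite (imetric_sym d_metric 0) !imetric_mnormB opprK !subr0 mnormN.
Qed.

Lemma lerB_mnormD x y : mnorm d x - mnorm d y <= mnorm d (x + y).
Proof. by have := ler_mnormD (x + y) (- y); rewrite addrK mnormN; lra. Qed.

Lemma mnorm_ge0 x : 0 <= mnorm d x.
Proof.
have := ler_mnormD x (- x).
by rewrite subrr mnormN {1}/mnorm (imetricxx d_metric); lra.
Qed.

Lemma imetricDD x x' y y' : d (x + y) (x' + y') <= d x x' + d y y'.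
Proof. by rewrite !imetric_mnormB opprD addrACA ler_mnormD. Qed.

Lemma unbounded_double (K : R) :
  ereal_sup [set (mnorm d (x + x))%:E | x in [set: X]] = +oo%E ->
  exists x, K < mnorm d (x + x).
Proof.
move=> sup_oo; have : (K%:E < +oo)%E by rewrite ltry.
rewrite -sup_oo => /ereal_sup_gt[_ [x _ <-]].
by rewrite lte_fin => Kx; exists x.
Qed.

Lemma limsup_min_mnorm_lty (F : X -> X -> R) :
  (limsup_min_mnorm d F < +oo)%E ->
  exists r C : R, forall x y, r <= mnorm d x -> r <= mnorm d y -> F x y <= C.
Proof.
move=> /ereal_inf_lt[_ [r _ <-]] sup_fin; exists r.
set S := ereal_sup _ in sup_fin.
have FS x y : r <= mnorm d x -> r <= mnorm d y -> ((F x y)%:E <= S)%E.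
  by move=> rx ry; apply: ereal_sup_ubound; exists (x, y).
(* [fine] takes the default value 0 when [S] is [-oo]; this is harmless, since by [FS] no pair is
   then in range. *)
exists (fine S) => x y rx ry; have := FS x y rx ry.
by case: S sup_fin {FS} => [s| |].
Qed.

End InvariantMetric.

(** Let [C] bound the product for entries of norm at least [r]. Once [phi] reaches
    [(|C| + 1) / eps], a Cauchy difference above [eps] would push the product past [|C| + 1], hence
    past [C]. *)
Lemma limsup_cauchy_difference_small (R : realType) (X Y : zmodType)
    (d : X -> X -> R) (rho : Y -> Y -> R) (phi : R -> R) (f : X -> Y) (eps : R) :
  invariant_metric rho -> phi t @[t --> +oo] --> +oo ->
  (limsup_min_mnorm d (fun x y : X =>
     phi (mnorm d (x - y)) * mnorm rho (f (x + y) - f x - f y))%R < +oo)%E ->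
  0 < eps ->
  exists T : R, 0 <= T /\
    forall x y, T <= mnorm d x -> T <= mnorm d y -> T <= mnorm d (x - y) ->
    rho (f (x + y)) (f x + f y) <= eps.
Proof.
move=> rho_metric /cvgryPge phi_oo /limsup_min_mnorm_lty[r [C FC]] eps_gt0.
have [M [_ phiM]] := phi_oo ((`|C| + 1) / eps).
(* [phiM] asks for a strict inequality [M < t], whereas the threshold is non-strict, hence
   [M + 1]. *)
exists (Num.max 0 (Num.max r (M + 1))); split; first by rewrite le_max lexx.
move=> x y; rewrite !ge_max => /and3P[_ rx _] /and3P[_ ry _] /and3P[_ _ Mxy].
have := FC x y rx ry.
rewrite -addrA -opprD -(imetric_mnormB rho_metric) => phiC.
have : (`|C| + 1) / eps <= phi (mnorm d (x - y)) by apply: phiM => /=; lra.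
rewrite ler_pdivrMr // => C_le.
have C_norm := ler_norm C; have C_ge0 := normr_ge0 C.
rewrite leNgt; apply/negP => eps_lt.
have phi_gt0 : 0 < phi (mnorm d (x - y)) by rewrite -(pmulr_lgt0 _ eps_gt0); lra.
by move: eps_lt; rewrite -(ltr_pM2l phi_gt0); lra.
Qed.

(* [phi] is only evaluated at nonnegative reals and at infinity, so a total
   function [R -> R] stands for a function on [0, +oo). *)
Theorem theorem5 (R : realType) (X Y : zmodType)
    (d : X -> X -> R) (rho : Y -> Y -> R)
    (d_metric : invariant_metric d) (rho_metric : invariant_metric rho)
    (X2_unbounded : ereal_sup [set (mnorm d (x + x))%:E | x in [set: X]] = +oo%E)
    (phi : R -> R) (phi_oo : phi t @[t --> +oo] --> +oo)
    (f : X -> Y)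
    (f_limsup : (limsup_min_mnorm d (fun x y : X =>
        phi (mnorm d (x - y)) * mnorm rho (f (x + y) - f x - f y))%R < +oo)%E) :
  forall x y : X, f (x + y) = f x + f y.
Proof.
move=> x y; apply: (imetric_positivity rho_metric).
have rho_ge0 : 0 <= rho (f (x + y)) (f x + f y).
  by rewrite (imetric_mnormB rho_metric) (mnorm_ge0 rho_metric).
apply/eqP; rewrite eq_le rho_ge0 andbT; apply/ler_addgt0Pl => eps eps_gt0.
rewrite addr0.
have eps5_gt0 : 0 < eps / 5 by lra.
have [T [T_ge0 small]] :=
  limsup_cauchy_difference_small rho_metric phi_oo f_limsup eps5_gt0.
set N := mnorm d.
have N_ge0 := mnorm_ge0 d_metric : forall z, 0 <= N z.
have ND := ler_mnormD d_metric : forall z w, N (z + w) <= N z + N w.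
have NB := lerB_mnormD d_metric : forall z w, N z - N w <= N (z + w).
have NN := mnormN d_metric : forall z, N (- z) = N z.
have [x_ge0 y_ge0 xy_le] : [/\ 0 <= N x, 0 <= N y & N (x + y) <= N x + N y].
  by split.
pose K := T + N x + N y.
(* [K] is the threshold plus the most that a shift by [x], [y], [x + y] or [x - y] can cost.
   Subadditivity turns the choices below into [N u > K], [N v > K + N u] and
   [N (v + v) > 2 * K + N (u + u)]. *)
have [u u_large] := unbounded_double (2 * K) X2_unbounded.
have [v v_large] := unbounded_double (2 * K + 2 * N u) X2_unbounded.
rewrite -/N /K in small u_large v_large.
have uu := ND u u; have vv := ND v v.
have Buv : N v - N u <= N (u - v).
  by have := NB v (- u); rewrite NN -(NN (u - v)) opprB.
have Duv : N v - N u <= N (u + v) by rewrite [u + v]addrC NB.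
have Duv2 : N (v + v) - N (u + u) <= N ((u + v) + (u + v)).
  by rewrite addrACA [u + u + _]addrC NB.
have subl z w : N w - N z <= N (z - w).
  by have := NB (- w) z; rewrite NN [- w + z]addrC.
(* Splitting [z] as [w + (z - w)] gives entries whose difference is [w + w - z]. This is why doubles
   have to be large: [N w] alone does not control [N (w + w)] from below. *)
have subr2 z w : N (w + w) - N z <= N (w - (z - w)).
  by rewrite opprB addrA -{1}(NN z) NB.
have xyE : x + y = (u + v) + ((x - u) + (y - v)).
  by rewrite addrACA ![_ + (_ - _)]addrC !subrK.
have bE : x - u + (y - v) = x + y - (u + v) by rewrite opprD addrACA.
have Bbe : N (u - v) - N x - N y <= N ((x - u) - (y - v)).
  have -> : (x - u) - (y - v) = (x - y) - (u - v).
    by rewrite !opprD !opprK addrACA.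
  by have := subl (x - y) (u - v); have := ND x (- y); rewrite NN; lra.
have xu := subl x u; have yv := subl y v.
have xu2 := subr2 x u; have yv2 := subr2 y v.
have xyuv := subl (x + y) (u + v); have xyuv2 := subr2 (x + y) (u + v).
have h_ab : rho (f x) (f u + f (x - u)) <= eps / 5.
  by rewrite -[in f x](subrK u x) addrC; apply: small; lra.
have h_ce : rho (f y) (f v + f (y - v)) <= eps / 5.
  by rewrite -[in f y](subrK v y) addrC; apply: small; lra.
have h_ac : rho (f (u + v)) (f u + f v) <= eps / 5.
  by apply: small; lra.
have h_be : rho (f ((x - u) + (y - v))) (f (x - u) + f (y - v)) <= eps / 5.
  by apply: small; lra.
have h_sum : rho (f (x + y)) (f (u + v) + f ((x - u) + (y - v))) <= eps / 5.
  by rewrite xyE; apply: small; rewrite ?bE; lra.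
(* The path from [f (x + y)] to [f x + f y] passes through [f (u + v) + f ((x - u) + (y - v))] and
   then the sum of the four values of [f] at [u], [v], [x - u], [y - v]. Its legs cost one, two and
   two times [eps / 5]. *)
have h1 := imetricDD rho_metric (f x) (f u + f (x - u)) (f y) (f v + f (y - v)).
have h2 := imetricDD rho_metric (f (u + v)) (f u + f v)
  (f ((x - u) + (y - v))) (f (x - u) + f (y - v)).
rewrite addrACA (imetric_sym rho_metric) in h1.
have h3 := imetric_triangle rho_metric (f (u + v) + f ((x - u) + (y - v)))
  (f (x + y)) (f x + f y).
have h4 := imetric_triangle rho_metric (f u + f v + (f (x - u) + f (y - v)))
  (f (u + v) + f ((x - u) + (y - v))) (f x + f y).
lra.
Qed.
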